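(* The three-element chain cannot be represented as the congruence lattice of an SPS lattice; that is, there is no slim, planar, semimodular lattice $L$ such that $\operatorname{Con} L$ is isomorphic to the three-element chain.
   Context: A lattice is planar if it is finite and has a planar Hasse diagram (one that can be drawn in the plane, with each covering pair $x \prec y$ drawn as a straight line segment going upward from $x$ to $y$, so that edges meet only at common endpoints). A lattice $L$ is semimodular (upper semimodular) if for all $a, b, c \in L$, whenever $b$ covers $a$, then $b \vee c$ covers or equals $a \vee c$. A planar semimodular lattice is slim if it has no sublattice isomorphic to $\mathsf{M}_3$, the five-element modular non-distributive lattice with a bottom, a top and three pairwise incomparable elements between them. An SPS lattice is a slim, planar, semimodular lattice. $\operatorname{Con} L$ denotes the lattice of all congruence relations of the lattice $L$, ordered by inclusion. *)

(* Defs.v *)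
From HB Require Import structures.
From mathcomp Require Import all_boot all_order all_algebra.
From mathcomp Require Import reals.

Set Implicit Arguments.
Unset Strict Implicit.
Unset Printing Implicit Defensive.

Import Order.TTheory GRing.Theory Num.Theory.

Local Open Scope order_scope.

Definition covered_by (d : Order.disp_t) (T : porderType d) (x y : T) : Prop :=
  x < y /\ forall z : T, ~ (x < z < y).

Definition isomorphic (d d' : Order.disp_t)
    (K : latticeType d) (L : latticeType d') : Prop :=
  exists f : {lmorphism K -> L}, bijective f.

(* The image of an injective lattice morphism is a sublattice of the codomain
   isomorphic to the domain, and every sublattice isomorphic to [K] arises
   in this way. *)
Definition has_sublattice (d d' : Order.disp_t)
    (K : latticeType d) (L : latticeType d') : Prop :=
  exists f : {lmorphism K -> L}, injective f.

Definition semimodular (d : Order.disp_t) (L : latticeType d) : Prop :=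
  forall a b c : L, covered_by a b ->
    covered_by (a `|` c) (b `|` c) \/ a `|` c = b `|` c.

Inductive M3 : Type := M3bot | M3atom of 'I_3 | M3top.

Definition M3_encode (x : M3) : option (option 'I_3) :=
  match x with
  | M3bot => None
  | M3top => Some None
  | M3atom i => Some (Some i)
  end.

Definition M3_decode (x : option (option 'I_3)) : M3 :=
  match x with
  | None => M3bot
  | Some None => M3top
  | Some (Some i) => M3atom i
  end.

Lemma M3_encodeK : cancel M3_encode M3_decode.
Proof. by case. Qed.

HB.instance Definition _ := Finite.copy M3 (can_type M3_encodeK).

Definition M3_le (x y : M3) : bool :=
  match x, y with
  | M3bot, _ => true
  | _, M3top => true
  | M3atom i, M3atom j => i == j
  | _, _ => false
  end.

Definition M3_meet (x y : M3) : M3 :=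
  match x, y with
  | M3top, z => z
  | z, M3top => z
  | M3atom i, M3atom j => if i == j then M3atom i else M3bot
  | _, _ => M3bot
  end.

Definition M3_join (x y : M3) : M3 :=
  match x, y with
  | M3bot, z => z
  | z, M3bot => z
  | M3atom i, M3atom j => if i == j then M3atom i else M3top
  | _, _ => M3top
  end.

Lemma M3_le_refl : reflexive M3_le.
Proof. by case=> //= i; rewrite eqxx. Qed.

Lemma M3_le_anti : antisymmetric M3_le.
Proof. by case=> [|i|] [|j|] //= /andP[/eqP -> _]. Qed.

Lemma M3_le_trans : transitive M3_le.
Proof. by case=> [|i|] [|j|] [|k|] //= /eqP ->. Qed.

Fact M3_display : Order.disp_t. Proof. exact: Order.Disp tt tt. Qed.

HB.instance Definition _ := Order.Le_isPOrder.Build M3_display M3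
  M3_le_refl M3_le_anti M3_le_trans.

Lemma M3_meetP (x y z : M3) : (x <= M3_meet y z) = (x <= y) && (x <= z).
Proof.
rewrite /Order.le /=; case: x y z => [|i|] [|j|] [|k|] //=;
  rewrite ?andbT ?andbF //; case: (eqVneq j k) => [ejk|njk] //=;
  rewrite -?ejk ?andbb //.
by case: (eqVneq i j) => [->|//]; rewrite (negbTE njk).
Qed.

Lemma M3_joinP (x y z : M3) : (M3_join x y <= z) = (x <= z) && (y <= z).
Proof.
rewrite /Order.le /=; case: x y z => [|i|] [|j|] [|k|] //=;
  rewrite ?andbT ?andbF //; case: (eqVneq i j) => [eij|nij] //=;
  rewrite -?eij ?andbb //.
by case: (eqVneq i k) => [<-|//]; rewrite eq_sym (negbTE nij).
Qed.

HB.instance Definition _ := Order.POrder_MeetJoin_isLattice.Build M3_display M3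
  M3_meetP M3_joinP.

Definition slim (d : Order.disp_t) (L : latticeType d) : Prop :=
  ~ has_sublattice M3 L.

Definition on_segment (R : realType) (p q m : R * R) : Prop :=
  exists2 t : R, (0 <= t <= 1)%R &
    m = (((1 - t) * p.1 + t * q.1)%R, ((1 - t) * p.2 + t * q.2)%R).

(* [pos] places the elements of [L] at distinct points of the plane [R * R],
   whose second coordinate is the height; "upward" means of increasing
   height. *)
Definition planar_diagram (R : realType) (d : Order.disp_t) (L : porderType d)
    (pos : L -> R * R) : Prop :=
  [/\ injective pos,
      forall x y : L, covered_by x y -> ((pos x).2 < (pos y).2)%R
    & forall (x y x' y' : L) (m : R * R),
        covered_by x y -> covered_by x' y' -> (x, y) <> (x', y') ->
        on_segment (pos x) (pos y) m -> on_segment (pos x') (pos y') m ->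
        exists z : L, [/\ m = pos z, z = x \/ z = y & z = x' \/ z = y']].

(* Finiteness, the other half of planarity, is carried by the type of [L]. *)
Definition planar (R : realType) (d : Order.disp_t) (L : finTBLatticeType d)
  : Prop := exists pos : L -> R * R, planar_diagram pos.

Definition SPS (R : realType) (d : Order.disp_t) (L : finTBLatticeType d)
  : Prop := [/\ slim L, planar R L & semimodular L].

Definition congruence (d : Order.disp_t) (L : finLatticeType d)
    (r : {set L * L}) : bool :=
  [&& [forall x, (x, x) \in r],
      [forall x, forall y, ((x, y) \in r) ==> ((y, x) \in r)],
      [forall x, forall y, forall z,
        ((x, y) \in r) && ((y, z) \in r) ==> ((x, z) \in r)]
    & [forall x, forall y, forall x', forall y',
        ((x, y) \in r) && ((x', y') \in r) ==>
        ((x `&` x', y `&` y') \in r) && ((x `|` x', y `|` y') \in r)]].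

Record Con (d : Order.disp_t) (L : finLatticeType d) : Type :=
  MkCon { con_rel :> {set L * L}; con_relP : congruence con_rel }.

HB.instance Definition _ d (L : finLatticeType d) :=
  [isSub of Con L for @con_rel d L].
HB.instance Definition _ d (L : finLatticeType d) := [Finite of Con L by <:].

Fact con_display : Order.disp_t. Proof. exact: Order.Disp tt tt. Qed.

Section ConLattice.
Variables (d : Order.disp_t) (L : finLatticeType d).
Implicit Types (r s : {set L * L}) (a b c : Con L).

Lemma congruenceP r :
  reflect [/\ forall x, (x, x) \in r,
              forall x y, (x, y) \in r -> (y, x) \in r,
              forall x y z, (x, y) \in r -> (y, z) \in r -> (x, z) \in r
            & forall x y x' y', (x, y) \in r -> (x', y') \in r ->
                (x `&` x', y `&` y') \in r /\ (x `|` x', y `|` y') \in r]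
          (congruence r).
Proof.
apply: (iffP and4P) => [[/forallP rr /forallP rs /forallP rt /forallP rc]|].
  split=> // [x y|x y z xy yz|x y x' y' xy xy'].
  - by move/forallP: (rs x) => /(_ y)/implyP.
  - move/forallP: (rt x) => /(_ y)/forallP/(_ z)/implyP; apply.
    by rewrite xy yz.
  - move/forallP: (rc x) => /(_ y)/forallP/(_ x')/forallP/(_ y')/implyP.
    by rewrite xy xy' => /(_ isT)/andP.
case=> rr rs rt rc; split; apply/forallP => x //; apply/forallP => y.
- by apply/implyP/rs.
- by apply/forallP => z; apply/implyP => /andP[]; apply: rt.
- apply/forallP => x'; apply/forallP => y'; apply/implyP => /andP[xy xy'].
  by apply/andP; apply: rc.
Qed.

Lemma congruence_bigcap (P : pred (Con L)) :
  congruence (\bigcap_(c | P c) con_rel c).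
Proof.
apply/congruenceP; split=> [x|x y /bigcapP xy|x y z /bigcapP xy /bigcapP yz
    |x y x' y' /bigcapP xy /bigcapP xy'].
- by apply/bigcapP => c _; have /congruenceP[rr _ _ _] := con_relP c; apply: rr.
- apply/bigcapP => c Pc; have /congruenceP[_ rs _ _] := con_relP c.
  exact/rs/xy.
- apply/bigcapP => c Pc; have /congruenceP[_ _ rt _] := con_relP c.
  exact: rt (xy c Pc) (yz c Pc).
- split; apply/bigcapP => c Pc; have /congruenceP[_ _ _ rc] := con_relP c;
    by have [] := rc _ _ _ _ (xy c Pc) (xy' c Pc).
Qed.

Definition con_le a b : bool := con_rel a \subset con_rel b.

Definition con_inf (P : pred (Con L)) : Con L := MkCon (congruence_bigcap P).

Definition con_meet a b : Con L := con_inf [pred c | (c == a) || (c == b)].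

Definition con_join a b : Con L := con_inf [pred c | con_le a c && con_le b c].

Lemma con_le_refl : reflexive con_le.
Proof. by move=> a; apply: subxx. Qed.

Lemma con_le_anti : antisymmetric con_le.
Proof. by move=> a b ab; apply/val_inj/eqP; rewrite eqEsubset. Qed.

Lemma con_le_trans : transitive con_le.
Proof. by move=> b a c; apply: subset_trans. Qed.

HB.instance Definition _ := Order.Le_isPOrder.Build con_display (Con L)
  con_le_refl con_le_anti con_le_trans.

Lemma con_meetP a b c : (a <= con_meet b c) = (a <= b) && (a <= c).
Proof.
apply/bigcapsP/andP => [h|[ab ac] e /orP[] /eqP -> //].
by split; apply: h; rewrite inE eqxx ?orbT.
Qed.

Lemma con_joinP a b c : (con_join a b <= c) = (a <= c) && (b <= c).
Proof.
apply/idP/idP => [abc|h]; last exact: (bigcap_inf c).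
by apply/andP; split; apply: con_le_trans abc; apply/bigcapsP => e /andP[].
Qed.

HB.instance Definition _ :=
  Order.POrder_MeetJoin_isLattice.Build con_display (Con L)
    con_meetP con_joinP.

End ConLattice.

(* Main.v *)
Require Import Defs.
From HB Require Import structures.
From mathcomp Require Import all_boot all_order all_algebra.
From mathcomp Require Import reals.
From mathcomp Require Import classical_sets topology normedtype.
From mathcomp Require Import ring.

(** In an SPS lattice every element has at most two covers.  Indeed, let p, q,
    r be three covers of z.  If two of their pairwise joins coincide, then all
    three do, and z, p, q, r and the join form an M_3.  Otherwise z lies at the
    bottom of a cube of coverings; if q leaves z between p and r, the upward
    path z, q, p \/ q, p \/ q \/ r starts between the paths z, p, p \/ r and
    z, r, p \/ r and must end above p \/ r, so by the intermediate value
    theorem it meets one of them, against planarity.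

    With at most two covers everywhere, every atom a is join-prime: if x and y
    are incomparable and not above a, then x /\ y has three covers, namely
    one below x, one below y, and a \/ (x /\ y).  The same holds for a cover
    of the unique atom.  So a lattice with at least three elements has two
    prime filters; the two resulting two-block congruences are incomparable,
    and the congruence lattice is not a chain. *)

Set Implicit Arguments.
Unset Strict Implicit.
Unset Printing Implicit Defensive.

Import Order.TTheory GRing.Theory Num.Theory numFieldNormedType.Exports.

Local Open Scope order_scope.

(** * Coverings, and the joins of covers under semimodularity *)

Section Covers.
Variables (d : Order.disp_t) (L : latticeType d).
Implicit Types x y z : L.

Lemma covered_by_le x y z : covered_by x y -> x <= z <= y -> z = x \/ z = y.
Proof.
move=> [_ xy] /andP[]; rewrite !le_eqVlt.
case: eqP => [->|_ /= xz]; first by left.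
by case: eqP => [|_ /= zy]; [right|case: (xy z); rewrite xz].
Qed.

Lemma covered_by_not_le x y z :
  covered_by x y -> covered_by x z -> y <> z -> ~~ (y <= z).
Proof.
move=> xy xz; apply: contra_notN => yz.
case: (covered_by_le (z := y) xz) => [|yx|//]; first by rewrite ltW ?yz ?xy.1.
by have := xy.1; rewrite yx ltxx.
Qed.

Lemma covered_by_meet x y z :
  covered_by x y -> covered_by x z -> y <> z -> y `&` z = x.
Proof.
move=> xy xz yz; case: (covered_by_le (z := y `&` z) xy) => // [|/eqP].
  by rewrite leIl lexI !ltW ?xy.1 ?xz.1.
by rewrite -leEmeet (negPf (covered_by_not_le xy xz yz)).
Qed.

Lemma covered_by_joinr x y z : semimodular L ->
  covered_by x y -> covered_by x z -> y <> z -> covered_by z (y `|` z).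
Proof.
move=> sm xy xz yz; have := sm _ _ z xy.
have -> : x `|` z = z by apply/join_idPr; rewrite ltW ?xz.1.
case=> // /esym/join_idPr zy.
by have := covered_by_not_le xy xz yz; rewrite zy.
Qed.

Lemma covered_by_joinl x y z : semimodular L ->
  covered_by x y -> covered_by x z -> y <> z -> covered_by y (y `|` z).
Proof.
by move=> sm xy xz yz; rewrite joinC; apply: (covered_by_joinr sm xz xy) => /esym.
Qed.

End Covers.

(** Among the elements above [x] and at most [y], one with the fewest elements below it works. *)
Lemma exists_cover (d : Order.disp_t) (T : finPOrderType d) (x y : T) :
  x < y -> exists2 c, covered_by x c & c <= y.
Proof.
move=> xy; pose P (u : T) := x < u <= y.
have Py : P y by rewrite /P xy lexx.
case: (@arg_minnP _ y P (fun u => #|[set w | w <= u]|) Py) => c /andP[xc cy] cmin.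
exists c => //; split=> // w /andP[xw wc].
have /cmin : P w by rewrite /P xw (le_trans (ltW wc)).
apply/negP; rewrite -ltnNge; apply/proper_card/properP; split.
  by apply/fintype.subsetP => v; rewrite !inE => /le_trans; apply; apply: ltW.
by exists c; rewrite !inE ?lexx // lt_geF.
Qed.

Lemma diamond_sublattice (d : Order.disp_t) (L : latticeType d)
    (z t : L) (e : 'I_3 -> L) :
  injective e -> (forall i, z < e i < t) ->
  (forall i j, i != j -> e i `&` e j = z) ->
  (forall i j, i != j -> e i `|` e j = t) -> has_sublattice M3 L.
Proof.
move=> inj_e zet eI eU.
have ze i : z < e i by case/andP: (zet i).
have et i : e i < t by case/andP: (zet i).
have zt : z < t := lt_trans (ze 0%R) (et 0%R).
pose f (x : M3) := match x with M3bot => z | M3atom i => e i | M3top => t end.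
have fI : {morph f : x y / x `&` y}.
  move=> x y; rewrite (_ : x `&` y = M3_meet x y) //.
  case: x y => [|i|] [|j|] /=; apply/esym;
    try by [apply/meet_idPl; rewrite ?ltW | apply/meet_idPr; rewrite ?ltW
            | exact: meetxx].
  by have [->|/eI ->//] := eqVneq i j; rewrite meetxx.
have fU : {morph f : x y / x `|` y}.
  move=> x y; rewrite (_ : x `|` y = M3_join x y) //.
  case: x y => [|i|] [|j|] /=; apply/esym;
    try by [apply/join_idPl; rewrite ?ltW | apply/join_idPr; rewrite ?ltW
            | exact: joinxx].
  by have [->|/eU ->//] := eqVneq i j; rewrite joinxx.
have f_le : {homo f : x y / x <= y}.
  by move=> x y /meet_idPl xy; apply/meet_idPl; rewrite -fI xy.
pose fO := Order.isOrderMorphism.Build _ _ _ _ f f_le.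
pose fM := Order.isMeetLatticeMorphism.Build _ _ _ _ f fI.
pose fJ := Order.isJoinLatticeMorphism.Build _ _ _ _ f fU.
pose F : {lmorphism M3 -> L} := HB.pack f fO fM fJ.
exists F => -[|i|] [|j|] //= exy; 
  try by [have := ze i; rewrite exy ltxx | have := ze j; rewrite -exy ltxx
   | have := et i; rewrite exy ltxx | have := et j; rewrite -exy ltxx
   | move: zt; rewrite exy ltxx].
by rewrite (inj_e _ _ exy).
Qed.

(** * Slimness, and join-prime elements when covers come at most in pairs *)

Section TwoCovers.
Variables (d : Order.disp_t) (L : finTBLatticeType d).
Hypothesis sm : semimodular L.

(** If the two joins agree, [q \/ r] lies between [q] and its cover [p \/ q]; it is not [q], so all
    three joins agree and an M_3 appears. *)
Lemma slim_covers_join (z p q r : L) : slim L ->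
  covered_by z p -> covered_by z q -> covered_by z r ->
  p <> q -> p <> r -> q <> r -> p `|` q <> p `|` r.
Proof.
move=> sl zp zq zr pq pr qr epr; apply: sl.
have tq : covered_by q (p `|` q) by apply: covered_by_joinr zp zq pq.
have eqr : q `|` r = p `|` q.
  case: (covered_by_le (z := q `|` r) tq) => [|/join_idPl rq|//].
    by rewrite leUl leUx leUr epr leUr.
  by have := covered_by_not_le zr zq (not_eq_sym qr); rewrite rq.
have tp : covered_by p (p `|` q) by apply: covered_by_joinl zp zq pq.
have tr : covered_by r (p `|` q).
  by rewrite epr; apply: covered_by_joinr zp zr pr.
have I3 (P : 'I_3 -> Prop) : P ord0 -> P (inord 1) -> P (inord 2) -> forall i, P i.
  move=> P0 P1 P2 i; rewrite -(inord_val i).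
  by case: i => -[|[|[|//]]] /= _ //; rewrite (_ : inord 0 = ord0) //;
    apply/val_inj; rewrite /= inordK.
pose e (i : 'I_3) := nth z [:: p; q; r] i.
have e0 : e ord0 = p by [].
have e1 : e (inord 1) = q by rewrite /e inordK.
have e2 : e (inord 2) = r by rewrite /e inordK.
apply: (@diamond_sublattice _ _ z (p `|` q) e).
- by elim/I3; elim/I3; rewrite ?e0 ?e1 ?e2 // => /esym.
- by elim/I3; rewrite ?e0 ?e1 ?e2; rewrite ?zp.1 ?zq.1 ?zr.1 ?tp.1 ?tq.1 ?tr.1.
- have epq := covered_by_meet zp zq pq; have epr' := covered_by_meet zp zr pr.
  have eqr' := covered_by_meet zq zr qr.
  by elim/I3; elim/I3; rewrite ?e0 ?e1 ?e2 ?eqxx // => _; rewrite // meetC.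
- by elim/I3; elim/I3; rewrite ?e0 ?e1 ?e2 ?eqxx // => _; rewrite // joinC.
Qed.

(** Supplied by [planar_covers]; assuming it here keeps the order-theoretic argument apart from the
    geometry. *)
Hypothesis two_covers : forall z p q r : L,
  covered_by z p -> covered_by z q -> covered_by z r ->
  [\/ p = q, p = r | q = r].

(** Taking [a = \bot] handles atoms, and taking [a] the unique atom handles its covers. In both
    cases [a <= x /\ y], so semimodularity lifts the covering of [a] by [c] to [x /\ y]. *)
Lemma cover_join_prime (a c : L) : covered_by a c ->
  (forall x, x = \bot \/ a <= x) ->
  forall x y, (c <= x `|` y) = (c <= x) || (c <= y).
Proof.
move=> ac a_min x y; apply/idP/idP => [cxy|/orP[]]; last 2 first.
- by move=> cx; rewrite lexU2 ?cx.
- by move=> cy; rewrite lexU2 ?cy ?orbT.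
apply: contraLR cxy => /norP[ncx ncy].
case: (a_min x) => [->|ax]; first by rewrite join0x.
case: (a_min y) => [->|ay]; first by rewrite joinx0.
case: (boolP (x <= y)) => [/join_idPr ->//|nxy].
case: (boolP (y <= x)) => [/join_idPl ->//|nyx].
set z := x `&` y.
have az : a <= z by rewrite lexI ax.
have zx : z < x by rewrite lt_neqAle leIl andbT -leEmeet.
have zy : z < y by rewrite lt_neqAle leIr andbT eq_meetr.
have [x' zx' x'x] := exists_cover zx.
have [y' zy' y'y] := exists_cover zy.
have ncz : ~~ (c <= z) by apply: contra ncx => /le_trans; apply; apply: leIl.
have zc : covered_by z (c `|` z).
  have := sm z ac; rewrite (join_idPr az) => -[//|/esym/join_idPr].
  by rewrite (negPf ncz).
case: (two_covers zx' zy' zc) => [e|e|e].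
- have : x' <= z by rewrite lexI x'x e.
  by move=> x'z; have := zx'.1; rewrite (le_gtF x'z).
- by move: ncx; rewrite (le_trans _ x'x) // e leUl.
- by move: ncy; rewrite (le_trans _ y'y) // e leUl.
Qed.

Lemma two_join_primes (u : L) : \bot < u < \top ->
  exists a c : L, [/\ a <> c, a <> \bot, c <> \bot,
    forall x y, (a <= x `|` y) = (a <= x) || (a <= y)
    & forall x y, (c <= x `|` y) = (c <= x) || (c <= y)].
Proof.
case/andP=> u_gt0 u_lt1; have [a a_atom au] := exists_cover u_gt0.
have atom_neq0 (b : L) : covered_by \bot b -> b <> \bot.
  by case=> b_gt0 _ b0; rewrite b0 ltxx in b_gt0.
have primeP (b : L) : covered_by \bot b ->
    forall x y, (b <= x `|` y) = (b <= x) || (b <= y).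
  by move=> bP x y; apply: (cover_join_prime bP) => w; right; apply: le0x.
case: (boolP [exists b : L, (b != a) && [forall w, ~~ (\bot < w < b)]
                && (\bot < b)]).
  case/existsP=> b /andP[/andP[/eqP nba /forallP b_min] b_gt0].
  have b_atom : covered_by \bot b by split=> // w; apply/negP.
  by exists a, b; split; [exact/nesym|exact: atom_neq0|exact: atom_neq0
    |exact: primeP|exact: primeP].
move=> no_b; have a_min (x : L) : x = \bot \/ a <= x.
  have [->|x_neq0] := eqVneq x \bot; [by left|right].
  rewrite -lt0x in x_neq0; have [b b_atom bx] := exists_cover x_neq0.
  suff <- : b = a by [].
  apply/eqP; apply: contraR no_b => nba; apply/existsP; exists b.
  by rewrite nba b_atom.1 andbT; apply/forallP => w; apply/negP/b_atom.2.
(* With a single atom [a], the second join-prime is a cover of [a], which exists since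
   [a <= u < \top]. *)
have [c ac _] := exists_cover (le_lt_trans au u_lt1).
exists a, c; split; [|exact: atom_neq0| |exact: primeP|exact: (cover_join_prime ac)].
- by move=> eac; have := ac.1; rewrite -eac ltxx.
- by move=> c0; have := ac.1; rewrite c0 ltx0.
Qed.
End TwoCovers.

(** * Two-block congruences from join-prime elements *)

Section PrimeFilterCongruence.
Variables (d : Order.disp_t) (L : finTBLatticeType d).

(** The kernel of the characteristic map of the principal filter of [a]; for [a] join-prime this map
    preserves joins as well as meets. *)
Definition filter_rel (a : L) : {set L * L} :=
  [set xy | (a <= xy.1) == (a <= xy.2)].

Lemma filter_rel_congruence (a : L) :
  (forall x y, (a <= x `|` y) = (a <= x) || (a <= y)) ->
  congruence (filter_rel a).
Proof.
move=> aP; apply/congruenceP; split=> [x|x y|x y z|x y x' y']; rewrite !inE //=.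
- by rewrite eq_sym.
- by move=> /eqP->.
- by move=> /eqP xy /eqP xy'; rewrite !lexI !aP xy xy'.
Qed.

(** The relation of [c] separates [c] from [\bot], hence so does that of [a], and [a <= c]. The
    relation of [a] identifies [a] with [\top], hence so does that of [c], and [c <= a]. *)
Lemma filter_rel_subset (a c : L) : a <> \bot -> c <> \bot ->
  filter_rel a \subset filter_rel c -> a = c.
Proof.
move=> a0 c0 /fintype.subsetP sub_ac; apply: le_anti; apply/andP; split.
- have := sub_ac (c, \bot); rewrite !inE /= lexx !lex0 (introF eqP a0) (introF eqP c0).
  by case: (a <= c) => // /(_ isT).
- have := sub_ac (a, \top); rewrite !inE /= lexx !lex1 eqxx => /(_ isT).
  by move/eqP.
Qed.

(** Such a congruence is determined by whether it identifies [\bot] and [\top]. *)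
Lemma card_Con_le2 : (forall x : L, x = \bot \/ x = \top) -> (#|{: Con L}| <= 2)%N.
Proof.
move=> L2; rewrite -card_bool.
apply: (@leq_card _ _ (fun r : Con L => (\bot, \top) \in con_rel r)) => r s rs.
apply/val_inj/finset.setP => -[x y] /=.
have /congruenceP[rr rsym _ _] := con_relP r.
have /congruenceP[sr ssym _ _] := con_relP s.
case: (L2 x) (L2 y) => -> [] ->; rewrite ?rr ?sr //.
by apply/idP/idP; [move/rsym; rewrite rs => /ssym|move/ssym; rewrite -rs => /rsym].
Qed.

End PrimeFilterCongruence.

Lemma Con_not_chain3 (d : Order.disp_t) (L : finTBLatticeType d) :
  semimodular L ->
  (forall z p q r : L, covered_by z p -> covered_by z q -> covered_by z r ->
    [\/ p = q, p = r | q = r]) ->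
  ~ isomorphic (Con L) 'I_3.
Proof.
move=> sm two_covers [f f_bij].
have con_total (r s : Con L) : (r <= s) || (s <= r).
  have f_inj : injective f := bij_inj f_bij.
  have f_le (r' s' : Con L) : f r' <= f s' -> r' <= s'.
    move=> /meet_idPl e; apply/meet_idPl/f_inj; rewrite -[RHS]e; exact: omorphI.
  by have /orP[/f_le ->|/f_le ->] := le_total (f r) (f s); rewrite ?orbT.
case: (boolP [exists u : L, \bot < u < \top]) => [/existsP[u u01]|].
  have [a [c [nac a0 c0 aP cP]]] := two_join_primes sm two_covers u01.
  have /orP[] := con_total (MkCon (filter_rel_congruence aP))
                           (MkCon (filter_rel_congruence cP)).
    by move/(filter_rel_subset a0 c0).
  by move/(filter_rel_subset c0 a0)/esym.
(* Without an element strictly between the bounds there are too few congruences for a bijection with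
   ['I_3]. *)
move=> /existsPn no_u.
suff /card_Con_le2 : forall x : L, x = \bot \/ x = \top.
  by rewrite (bij_eq_card f_bij) card_ord.
move=> x; have := no_u x; rewrite lt0x ltx1 negb_and !negbK.
by case/orP=> /eqP; [left|right].
Qed.

(** * Chains of coverings as graphs of continuous functions of the height *)

Section Planarity.
Variables (R : realType) (d : Order.disp_t) (L : porderType d) (pos : L -> R * R).
Local Open Scope ring_scope.

Fixpoint cover_chain (x : L) (s : seq L) : Prop :=
  if s is y :: s' then covered_by x y /\ cover_chain y s' else True.

(** Horizontal displacement per unit of height, so that a larger slope means further to the
    right. *)
Definition slope (x y : L) : R :=
  ((pos y).1 - (pos x).1) / ((pos y).2 - (pos x).2).

(* The abscissa at height [h] of the polygonal line through [x :: s]; it is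
   constant below [x] and above the last vertex. *)
Fixpoint trace (x : L) (s : seq L) (h : R) : R :=
  if s is y :: s' then
    trace y s' h
      - slope x y * ((pos y).2 - Num.max (pos x).2 (Num.min (pos y).2 h))
  else (pos x).1.

(** Clamping the height with [max] and [min], rather than by cases, makes this a matter of
    composition. *)
Lemma trace_continuous (x : L) (s : seq L) : continuous (trace x s : R -> R).
Proof.
elim: s x => [|y s IHs] x /= h; first exact: cst_continuous.
apply: continuousB; first exact: IHs.
apply: continuousM; first exact: cst_continuous.
apply: continuousB; first exact: cst_continuous.
apply: continuous_max; first exact: cst_continuous.
by apply: continuous_min; first exact: cst_continuous.
Qed.

Hypothesis pos_planar : planar_diagram pos.

Lemma covered_by_height (x y : L) : covered_by x y -> (pos x).2 < (pos y).2.
Proof. by case: pos_planar => _ + _; apply. Qed.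

Lemma trace_low (x : L) (s : seq L) (h : R) :
  cover_chain x s -> h <= (pos x).2 -> trace x s h = (pos x).1.
Proof.
elim: s x => //= y s IHs x [/covered_by_height xy ys] hx.
have hy : h <= (pos y).2 by apply: le_trans hx (ltW xy).
rewrite IHs // (min_idPr _) // (max_idPl _) // /slope.
by field; rewrite subr_eq0 gt_eqF.
Qed.

Lemma trace_first (x y : L) (s : seq L) (h : R) :
  cover_chain x (y :: s) -> (pos x).2 <= h <= (pos y).2 ->
  trace x (y :: s) h = (pos x).1 + slope x y * (h - (pos x).2).
Proof.
move=> /= [/covered_by_height xy ys] /andP[xh hy].
rewrite trace_low // (min_idPr _) // (max_idPr _) // /slope.
by field; rewrite subr_eq0 gt_eqF.
Qed.

Lemma trace_next (x y : L) (s : seq L) (h : R) :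
  covered_by x y -> (pos y).2 <= h -> trace x (y :: s) h = trace y s h.
Proof.
move=> /covered_by_height xy yh /=.
by rewrite (min_idPl _) // (max_idPr (ltW _)) // subrr mulr0 subr0.
Qed.

Lemma cover_chain_height (x : L) (s : seq L) :
  cover_chain x s -> (pos x).2 <= (pos (last x s)).2.
Proof.
elim: s x => //= y s IHs x [/covered_by_height xy /IHs].
exact/le_trans/ltW.
Qed.

Lemma trace_high (x : L) (s : seq L) (h : R) :
  cover_chain x s -> (pos (last x s)).2 <= h -> trace x s h = (pos (last x s)).1.
Proof.
elim: s x => //= y s IHs x [xy ys] hs.
have yh : (pos y).2 <= h by apply: le_trans hs; apply: cover_chain_height.
by have /= -> := trace_next s xy yh; apply: IHs.
Qed.

Lemma trace_on_first_edge (x y : L) (s : seq L) (h : R) :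
  cover_chain x (y :: s) -> (pos x).2 <= h <= (pos y).2 ->
  on_segment (pos x) (pos y) (trace x (y :: s) h, h).
Proof.
move=> xys xhy; have hxy := covered_by_height xys.1.
have gt0 : 0 < (pos y).2 - (pos x).2 by rewrite subr_gt0.
exists ((h - (pos x).2) / ((pos y).2 - (pos x).2)).
  case/andP: xhy => xh hy; rewrite ler_pdivrMr // mul1r lerB // andbT.
  by rewrite divr_ge0 // ?subr_ge0 // ltW.
by rewrite trace_first // /slope; congr pair; field; rewrite subr_eq0 gt_eqF.
Qed.

(** Planarity speaks only of edges; this locates each point of a trace on one. *)
Lemma trace_on_edge (x y : L) (s : seq L) (h : R) :
  cover_chain x (y :: s) -> (pos x).2 <= h <= (pos (last y s)).2 ->
  exists u v, [/\ covered_by u v, u \in x :: y :: s, v \in y :: s &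
    on_segment (pos u) (pos v) (trace x (y :: s) h, h)].
Proof.
elim: s x y => [|w s IHs] x y xys /andP[xh hs].
  exists x, y; rewrite !inE !eqxx ?orbT; split=> //; first exact: xys.1.
  by apply: trace_on_first_edge; rewrite ?xh.
have [hy|yh] := leP h (pos y).2.
  exists x, y; rewrite !inE !eqxx ?orbT; split=> //; first exact: xys.1.
  by apply: trace_on_first_edge; rewrite ?xh.
have [xy yws] := xys.
have [|u [v [uv uin vin uvh]]] := IHs y w yws; first by rewrite ltW.
exists u, v; rewrite trace_next ?ltW //; split=> //.
  by rewrite inE uin orbT.
by rewrite inE vin orbT.
Qed.

(** A common point would lie on two edges, distinct because their upper ends are. By planarity it
    would be a vertex of both chains, hence [z], but it is higher than [z]. *)
Lemma chains_disjoint_traces (z p q : L) (s s' : seq L) (h : R) :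
  cover_chain z (p :: s) -> cover_chain z (q :: s') ->
  [predI p :: s & q :: s'] =1 pred0 ->
  (pos z).2 < h -> h <= (pos (last p s)).2 -> h <= (pos (last q s')).2 ->
  trace z (p :: s) h <> trace z (q :: s') h.
Proof.
move=> zps zqs disj zh hs hs' e.
have zNmem (x : L) t : cover_chain z t -> x \in t -> (pos z).2 < (pos x).2.
  elim: t (z) => //= y t IHt w [/covered_by_height wy yt].
  by rewrite inE => /predU1P[->//|/(IHt _ yt)]; apply: lt_trans.
have [u [v [uv uin vin uvh]]] := trace_on_edge zps (introT andP (conj (ltW zh) hs)).
have [u' [v' [uv' uin' vin' uvh']]] :=
  trace_on_edge zqs (introT andP (conj (ltW zh) hs')).
have disjN x : x \in p :: s -> x \in q :: s' -> False.
  by move=> xp xq; have := disj x; rewrite /= xp xq.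
case: pos_planar => _ _ /(_ u v u' v' (trace z (p :: s) h, h) uv uv').
case=> [[_ vv]| // | |x [hx xuv xuv']].
- by apply: disjN vin _; rewrite vv.
- by rewrite e.
have xP : x \in z :: p :: s.
  by case: xuv => -> //; rewrite inE vin orbT.
have xQ : x \in z :: q :: s'.
  by case: xuv' => -> //; rewrite inE vin' orbT.
have xz : x <> z by move=> xz; move: zh; rewrite -xz -hx ltxx.
move: xP xQ; rewrite in_cons => /predU1P[//|xP]; rewrite in_cons => /predU1P[//|xQ].
exact: disjN xP xQ.
Qed.

(** Edges of equal slope from [z] would overlap up to the lower of their upper ends. *)
Lemma slope_inj (z p q : L) :
  covered_by z p -> covered_by z q -> slope z p = slope z q -> p = q.
Proof.
move=> zp zq epq; have [//|/eqP npq] := eqVneq p q.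
pose h := Num.min (pos p).2 (pos q).2.
have zh : (pos z).2 < h by rewrite lt_min !covered_by_height.
have hp : h <= (pos p).2 by rewrite ge_min lexx.
have hq : h <= (pos q).2 by rewrite ge_min lexx orbT.
case: (@chains_disjoint_traces z p q [::] [::] h) => //.
  by move=> x /=; rewrite !inE; apply/negP => /andP[/eqP -> /eqP].
by rewrite !trace_first ?(ltW zh) ?epq.
Qed.

(** The slopes decide the order just above [z]; a later reversal would force a crossing. *)
Lemma trace_lt (z p q : L) (s s' : seq L) (h : R) :
  cover_chain z (p :: s) -> cover_chain z (q :: s') ->
  [predI p :: s & q :: s'] =1 pred0 -> slope z p < slope z q ->
  (pos z).2 < h -> h <= (pos (last p s)).2 -> h <= (pos (last q s')).2 ->
  trace z (p :: s) h < trace z (q :: s') h.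
Proof.
move=> zps zqs disj pq zh hs hs'; rewrite ltNge; apply/negP => le_qp.
have zp := covered_by_height zps.1; have zq := covered_by_height zqs.1.
(* Up to this height both chains are still on their first edges, where the traces are affine. *)
pose h0 := Num.min h (Num.min (pos p).2 (pos q).2).
have zh0 : (pos z).2 < h0 by rewrite !lt_min zh zp.
have h0h : h0 <= h by rewrite ge_min lexx.
have h0p : h0 <= (pos p).2 by rewrite !ge_min lexx orbT.
have h0q : h0 <= (pos q).2 by rewrite !ge_min lexx !orbT.
pose D k := trace z (q :: s') k - trace z (p :: s) k.
have D0 : 0 <= D h0.
  rewrite /D !trace_first ?(ltW zh0) // opprD addrACA subrr add0r -mulrBl.
  by rewrite mulr_ge0 // subr_ge0 ltW.
have D1 : D h <= 0 by rewrite subr_le0.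
have contD : {within `[h0, h], continuous D}%classic.
  apply: continuous_subspaceT => k.
  by apply: continuousB; apply: trace_continuous.
have [|k] := IVT h0h contD (v := 0).
  by rewrite ge_min le_max D0 D1 orbT.
rewrite in_itv /= => /andP[h0k kh] /eqP; rewrite subr_eq0 eq_sym => /eqP.
by apply: chains_disjoint_traces => //;
  [exact: lt_le_trans h0k|exact: le_trans hs|exact: le_trans hs'].
Qed.

(* The middle chain enters the region bounded by the two chains from [z] to
   [t], and cannot leave it below the height of [t]. *)
Lemma no_middle_chain (z p q r t : L) (s : seq L) :
  cover_chain z [:: p; t] -> cover_chain z [:: r; t] -> cover_chain z (q :: s) ->
  [predI [:: p; t] & q :: s] =1 pred0 -> [predI q :: s & [:: r; t]] =1 pred0 ->
  slope z p < slope z q -> slope z q < slope z r ->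
  (pos t).2 <= (pos (last q s)).2 -> False.
Proof.
move=> zpt zrt zqs disjl disjr pq qr ts.
have zt : (pos z).2 < (pos t).2.
  by apply: (lt_trans (covered_by_height zpt.1)); apply: covered_by_height zpt.2.1.
have lt_l := trace_lt zpt zqs disjl pq zt (lexx _) ts.
have lt_r := trace_lt zqs zrt disjr qr zt ts (lexx _).
have := lt_trans lt_l lt_r.
by rewrite (trace_high zpt) ?(trace_high zrt) ?ltxx //=.
Qed.

End Planarity.

(** * At most two covers in an SPS lattice *)

Lemma planar_covers (R : realType) (d : Order.disp_t) (L : finTBLatticeType d) :
  SPS R L -> forall z p q r : L,
  covered_by z p -> covered_by z q -> covered_by z r ->
  [\/ p = q, p = r | q = r].
Proof.
case=> sl [pos pos_planar] sm.
have covers_unordered (z p q r : L) :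
    covered_by z p -> covered_by z q -> covered_by z r ->
    (slope pos z p < slope pos z q < slope pos z r)%R -> False.
  move=> zp zq zr /andP[pq_lt qr_lt].
  have pq : p <> q by move=> e; move: pq_lt; rewrite e ltxx.
  have qr : q <> r by move=> e; move: qr_lt; rewrite e ltxx.
  have pr : p <> r by move=> e; have := lt_trans pq_lt qr_lt; rewrite e ltxx.
  pose t := p `|` r; pose w := p `|` q.
  have pt : covered_by p t := covered_by_joinl sm zp zr pr.
  have rt : covered_by r t := covered_by_joinr sm zp zr pr.
  have pw : covered_by p w := covered_by_joinl sm zp zq pq.
  have qw : covered_by q w := covered_by_joinr sm zp zq pq.
  (* Slimness makes [w] and [t] distinct covers of [p], so semimodularity yields the top [w \/ t] of
     the cube. *)
  have wt : w <> t := slim_covers_join sm sl zp zq zr pq pr qr.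
  have ws : covered_by w (w `|` t) := covered_by_joinl sm pw pt wt.
  have ts : covered_by t (w `|` t) := covered_by_joinr sm pw pt wt.
  (* A cover of [x] is never reached from [x] in two covering steps; this separates the atoms of the
     cube from its coatoms. *)
  have ncover2 (x y u v : L) :
      covered_by x y -> covered_by x u -> covered_by u v -> y <> v.
    by move=> xy xu uv e; apply: (xy.2 u); rewrite e xu.1 uv.1.
  have ne_lt (x y : L) : x < y -> x <> y by move=> xy e; rewrite e ltxx in xy.
  apply: (@no_middle_chain _ _ _ _ pos_planar z p q r t [:: w; w `|` t]) => //=.
  - move=> x /=; rewrite !inE; apply/negP => /andP[/orP[] /eqP -> /or3P[] /eqP] //.
    + exact: ne_lt pw.1.
    + exact: (ne_lt _ _ (lt_trans pw.1 ws.1)).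
    + exact/nesym/(ncover2 _ _ _ _ zq zp pt).
    + exact/nesym.
    + exact: ne_lt ts.1.
  - move=> x /=; rewrite !inE; apply/negP => /andP[/or3P[] /eqP -> /orP[] /eqP] //.
    + exact: (ncover2 _ _ _ _ zq zr rt).
    + exact/nesym/(ncover2 _ _ _ _ zr zq qw).
    + exact/nesym/ne_lt/(lt_trans rt.1 ts.1).
    + exact/nesym/ne_lt/ts.1.
  - by apply/ltW/(covered_by_height pos_planar).
move=> z p q r zp zq zr.
have [|npq] := eqVneq p q; first by constructor 1.
have [|npr] := eqVneq p r; first by constructor 2.
have [|nqr] := eqVneq q r; first by constructor 3.
have slope_neq (x y : L) : covered_by z x -> covered_by z y -> x != y ->
    (slope pos z x < slope pos z y)%R || (slope pos z y < slope pos z x)%R.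
  move=> zx zy; rewrite -neq_lt; apply: contraNneq.
  by move=> /(slope_inj pos_planar zx zy)/eqP.
exfalso; have cu := covers_unordered z.
(* Six of the eight cases are the orderings of the slopes; the other two are cyclic, against
   transitivity. *)
case/orP: (slope_neq _ _ zp zq npq) => pq; case/orP: (slope_neq _ _ zq zr nqr) => qr;
  case/orP: (slope_neq _ _ zp zr npr) => pr.
- by apply: (cu p q r); rewrite ?pq.
- by have := lt_trans (lt_trans pq qr) pr; rewrite ltxx.
- by apply: (cu p r q); rewrite ?pr.
- by apply: (cu r p q); rewrite ?pr.
- by apply: (cu q p r); rewrite ?pq.
- by apply: (cu q r p); rewrite ?qr.
- by have := lt_trans (lt_trans pr qr) pq; rewrite ltxx.
- by apply: (cu r q p); rewrite ?qr.
Qed.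

Theorem mainTheorem2 (R : realType) :
  ~ exists (d : Order.disp_t) (L : finTBLatticeType d),
      SPS R L /\ isomorphic (Con L) 'I_3.
Proof.
case=> d [L [sps]]; apply: Con_not_chain3 (planar_covers sps).
by case: sps.
Qed.
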